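(* Let $A \in \mathbb{M}_{n\times n}(\mathbb{R})$, $B \in \mathbb{M}_{n\times m}(\mathbb{R})$ with $(A,B)$ stabilizable, and let $Q=Q^\top$, $R=R^\top$ (not necessarily positive semidefinite). Assume that $f$ (defined in the context) has a strict local minimizer over $\mathcal S$, i.e., there exist $K_*\in\mathcal S$ and $\delta>0$ with $f(K_* )<f(K)$ for all $K\in\mathcal S$ with $0<\|K-K_*\|_F<\delta$. Let $K_0 \in \mathcal S$ and consider the natural gradient iterates $$K_{j+1} = K_j - \eta_j\, \mathbf{n}(K_j), \qquad \mathbf n(K) = 2\big(RK - B^\top X_K (A-BK)\big),$$ with stepsize $\eta_j = 1/\big(2\lambda_n(R + B^\top X_{K_j} B)\big)$, where $\lambda_n$ denotes the largest eigenvalue. Then all iterates lie in $\mathcal S$, and both the function values and the gains converge to their global minima at a linear rate: there exist $q_1 \in (0,1)$ and $c_1>0$ such that for all $j$, $$f(K_j) - f(K_* ) \le q_1^j\,(f(K_0)-f(K_* )), \qquad \|K_j - K_*\|_F^2 \le c_1 q_1^j \|K_0-K_*\|_F^2.$$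
   Context: $\mathcal S = \{K \in \mathbb{M}_{m\times n}(\mathbb{R}) : \rho(A-BK)<1\}$, $\rho$ the spectral radius. Fix a spanning set $\{z_1,\dots,z_n\}$ of $\mathbb{R}^n$ and let $\Sigma=\sum_i z_iz_i^\top$. For $K\in\mathcal S$, $X_K$ is the unique solution of $(A-BK)^\top X(A-BK)+Q+K^\top RK = X$, and $f(K)=\mathrm{Tr}(X_K\Sigma)$. Under the assumption, $K_*$ is the unique global minimizer of $f$ over $\mathcal S$. *)

(* Defs.v *)
From HB Require Import structures.
From mathcomp Require Import all_boot all_order all_algebra.
From mathcomp Require Import complex.
From mathcomp Require Import boolp reals.
Set Implicit Arguments. Unset Strict Implicit. Unset Printing Implicit Defensive.
Import Order.TTheory GRing.Theory Num.Theory.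
Local Open Scope ring_scope.

Section LQR.
Variable R : realType.
Variables n m : nat.

Definition schur_stable (M : 'M[R]_n) : Prop :=
  forall z : R[i], root (char_poly (map_mx (real_complex R) M)) z -> `|z| < 1.

Definition stabilizing (A : 'M[R]_n) (B : 'M[R]_(n, m)) (K : 'M[R]_(m, n)) : Prop :=
  schur_stable (A - B *m K).

Definition stabilizable (A : 'M[R]_n) (B : 'M[R]_(n, m)) : Prop :=
  exists K : 'M[R]_(m, n), stabilizing A B K.

Definition lyap_eq (A : 'M[R]_n) (B : 'M[R]_(n, m)) (Q : 'M[R]_n) (Rm : 'M[R]_m)
  (K : 'M[R]_(m, n)) (X : 'M[R]_n) : Prop :=
  (A - B *m K)^T *m X *m (A - B *m K) + Q + K^T *m Rm *m K = X.

(* X_K : the (unique, for K in S) solution of the Lyapunov equation *)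
Definition XK (A : 'M[R]_n) (B : 'M[R]_(n, m)) (Q : 'M[R]_n) (Rm : 'M[R]_m)
  (K : 'M[R]_(m, n)) : 'M[R]_n :=
  match pselect (exists X, lyap_eq A B Q Rm K X) with
  | left e => projT1 (cid e)
  | right _ => 0
  end.

Definition Sigma (z : 'I_n -> 'cV[R]_n) : 'M[R]_n := \sum_i (z i *m (z i)^T).

Definition spanning (z : 'I_n -> 'cV[R]_n) : Prop :=
  row_full (\matrix_(i < n, j < n) z i j 0).

Definition cost A B Q Rm (z : 'I_n -> 'cV[R]_n) (K : 'M[R]_(m, n)) : R :=
  \tr (XK A B Q Rm K *m Sigma z).

Definition frob2 (K : 'M[R]_(m, n)) : R := \sum_i \sum_j (K i j) ^+ 2.
Definition frob (K : 'M[R]_(m, n)) : R := Num.sqrt (frob2 K).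

Definition lam_max (M : 'M[R]_m) : R := sup (fun a : R => (eigenvalue M a : Prop)).

Definition nat_grad A B Q Rm (K : 'M[R]_(m, n)) : 'M[R]_(m, n) :=
  2%:R *: (Rm *m K - B^T *m XK A B Q Rm K *m (A - B *m K)).

Definition stepsize A B Q Rm (K : 'M[R]_(m, n)) : R :=
  1 / (2%:R * lam_max (Rm + B^T *m XK A B Q Rm K *m B)).

Fixpoint ng_iter A B Q Rm (K0 : 'M[R]_(m, n)) (j : nat) : 'M[R]_(m, n) :=
  match j with
  | 0 => K0
  | j'.+1 => let K := ng_iter A B Q Rm K0 j' in
             K - stepsize A B Q Rm K *: nat_grad A B Q Rm K
  end.

End LQR.

(* Main.v *)
Require Import Defs.
From HB Require Import structures.
From mathcomp Require Import all_boot all_order all_algebra.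
From mathcomp Require Import complex.
From mathcomp Require Import boolp reals.
From mathcomp Require Import ring lra.
Import Order.TTheory GRing.Theory Num.Theory.
Local Open Scope ring_scope.

(** Write [E_K = R K - B^T X_K (A - B K)], [H_K = R + B^T X_K B], and, for a
    direction [D], [gain_K(D) = D^T E_K + E_K^T D + D^T H_K D] as a quadratic form.
    Then [X_(K+D) - X_K] solves the Lyapunov equation of [A - B (K + D)] with
    right-hand side [gain_K(D)], so a sign of the gain is a sign of [X_(K+D) - X_K],
    and no continuity of [X_K] is needed.

    At a strict local minimizer [Ks], [D = - t E] and [D = t v 1^T] give a nonpositive gain
    for small [t > 0] unless [E = 0] and [v^T H v > 0]; hence [X_K] and [H_K] are
    minimal at [Ks], with [X_K - X_Ks >= (K - Ks)^T H_Ks (K - Ks)] in the Loewner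
    order. Since [H_K <= lambda I], the natural gradient step has
    [gain <= - E_K^T E_K / lambda], which gives the descent of [X_K]; the form
    [X_K - X_Ks] is a Lyapunov function proving that the step stays in [S].
    Completing the square in the gain from [K] to [Ks] bounds [f(K) - f(Ks)] by a
    multiple of [|E_K|^2], whence the linear rate. *)

(** * Quadratic forms of real matrices on column vectors *)

Definition dot {R : realType} {n : nat} (u v : 'cV[R]_n) : R := (u^T *m v) 0 0.

Section QuadraticForms.
Set Implicit Arguments. Unset Strict Implicit.
Variable R : realType.
Implicit Types n m : nat.

Lemma dotE n (u v : 'cV[R]_n) : dot u v = \sum_i u i 0 * v i 0.
Proof. by rewrite /dot mxE; apply: eq_bigr => i _; rewrite mxE. Qed.

Lemma dotC n (u v : 'cV[R]_n) : dot u v = dot v u.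
Proof. by rewrite !dotE; apply: eq_bigr => i _; rewrite mulrC. Qed.

Lemma dotDl n (u v w : 'cV[R]_n) : dot (u + v) w = dot u w + dot v w.
Proof. by rewrite /dot linearD mulmxDl mxE. Qed.

Lemma dotDr n (u v w : 'cV[R]_n) : dot w (u + v) = dot w u + dot w v.
Proof. by rewrite /dot mulmxDr mxE. Qed.

Lemma dotNl n (u w : 'cV[R]_n) : dot (- u) w = - dot u w.
Proof. by rewrite /dot linearN mulNmx mxE. Qed.

Lemma dotNr n (u w : 'cV[R]_n) : dot w (- u) = - dot w u.
Proof. by rewrite /dot mulmxN mxE. Qed.

Lemma dotZl n a (u w : 'cV[R]_n) : dot (a *: u) w = a * dot u w.
Proof. by rewrite /dot linearZ /= -scalemxAl mxE. Qed.

Lemma dotZr n a (u w : 'cV[R]_n) : dot w (a *: u) = a * dot w u.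
Proof. by rewrite /dot -scalemxAr mxE. Qed.

Lemma dot0l n (w : 'cV[R]_n) : dot 0 w = 0.
Proof. by rewrite /dot trmx0 mul0mx mxE. Qed.

Lemma dot0r n (w : 'cV[R]_n) : dot w 0 = 0.
Proof. by rewrite /dot mulmx0 mxE. Qed.

Lemma dotMl n m (M : 'M[R]_(n, m)) u v : dot (M *m u) v = dot u (M^T *m v).
Proof. by rewrite /dot trmx_mul mulmxA. Qed.

Lemma qf_congr n m (M : 'M[R]_(m, n)) (X : 'M[R]_m) x :
  dot x ((M^T *m X *m M) *m x) = dot (M *m x) (X *m (M *m x)).
Proof. by rewrite dotMl !mulmxA. Qed.

Lemma dot_sym n (M : 'M[R]_n) u v : M^T = M -> dot u (M *m v) = dot v (M *m u).
Proof. by move=> HM; rewrite dotC dotMl HM. Qed.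

Lemma dot_ge0 n (u : 'cV[R]_n) : 0 <= dot u u.
Proof. by rewrite dotE sumr_ge0 // => i _; rewrite -expr2 sqr_ge0. Qed.

Lemma dot_eq0 n (u : 'cV[R]_n) : dot u u <= 0 -> u = 0.
Proof.
move=> u0; have /eqP : dot u u = 0 by apply/le_anti; rewrite u0 dot_ge0.
rewrite dotE psumr_eq0 => [/allP u0' | i _]; last by rewrite -expr2 sqr_ge0.
apply/colP => i; rewrite mxE; apply/eqP.
by have := u0' i (mem_index_enum i); rewrite -expr2 sqrf_eq0.
Qed.

Lemma dot_gt0 n (u : 'cV[R]_n) : u != 0 -> 0 < dot u u.
Proof. by apply: contra_neqT; rewrite -leNgt => /dot_eq0. Qed.

(** Each product [|x i 0| * |x j 0|] is at most half the sum of the two squares; the double sum then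
    produces the factor [n]. *)
Lemma qf_entry_bound n (M : 'M[R]_n) (g : R) :
  (forall i j, `|M i j| <= g) ->
  forall x, `|dot x (M *m x)| <= g * n%:R * dot x x.
Proof.
move=> Mg x; rewrite dotE.
have -> : g * n%:R * dot x x =
    \sum_i \sum_j (g * ((x i 0 ^+ 2 + x j 0 ^+ 2) / 2%:R)).
  transitivity (\sum_(i < n) (g * ((n%:R * x i 0 ^+ 2 + dot x x) / 2%:R))).
    rewrite -mulr_sumr -mulr_suml big_split /= -mulr_sumr sumr_const card_ord.
    have -> : \sum_i x i 0 ^+ 2 = dot x x by rewrite dotE.
    by rewrite -mulr_natl; field.
  apply: eq_bigr => i _; rewrite -mulr_sumr -mulr_suml big_split /= sumr_const.
  have -> : \sum_i x i 0 ^+ 2 = dot x x by rewrite dotE.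
  by rewrite card_ord -(mulr_natl (x i 0 ^+ 2)).
apply: le_trans (ler_norm_sum _ _ _) _; apply: ler_sum => i _.
rewrite mxE mulr_sumr.
apply: le_trans (ler_norm_sum _ _ _) _; apply: ler_sum => j _.
rewrite !normrM mulrCA; apply: ler_pM; rewrite ?mulr_ge0 ?Mg //.
rewrite -(real_normK (num_real (x i 0))) -(real_normK (num_real (x j 0))).
have := sqr_ge0 (`|x i 0| - `|x j 0|); nra.
Qed.

Lemma mx_entries_bounded n m (M : 'M[R]_(n, m)) :
  exists2 g : R, 0 < g & forall i j, `|M i j| <= g.
Proof.
exists (1 + \sum_i \sum_j `|M i j|) => [|i j].
  by apply: ltr_pwDl => //; rewrite sumr_ge0 // => i _; rewrite sumr_ge0.
rewrite (bigD1 i) //= (bigD1 j) //=.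
have : 0 <= \sum_(k | k != j) `|M i k| by rewrite sumr_ge0.
have : 0 <= \sum_(k | k != i) \sum_j `|M k j|.
  by rewrite sumr_ge0 // => k _; rewrite sumr_ge0.
lra.
Qed.

Lemma qf_bound n (M : 'M[R]_n) :
  exists2 c : R, 0 < c & forall x, `|dot x (M *m x)| <= c * dot x x.
Proof.
have [g g0 Mg] := mx_entries_bounded M.
exists (g * n.+1%:R) => [|x]; first by rewrite mulr_gt0.
apply: le_trans (qf_entry_bound Mg x) _.
by rewrite ler_wpM2r ?dot_ge0 // ler_wpM2l ?ler_nat // ltW.
Qed.

Lemma mulmx_norm_bound n m (M : 'M[R]_(n, m)) :
  exists2 c : R, 0 < c & forall x, dot (M *m x) (M *m x) <= c * dot x x.
Proof.
have [c c0 Mc] := qf_bound (M^T *m M); exists c => // x.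
by rewrite dotMl mulmxA; apply: le_trans (ler_norm _) (Mc x).
Qed.

(** Write [a], [b], [c] for the values at [(u, u)], [(u, v)], [(v, v)]. The form at
    [s *: u + t *: v] is nonnegative, and [s = c], [t = - b] give [c (a c - b^2) >= 0]. *)
Lemma psd_CauchySchwarz n (M : 'M[R]_n) : M^T = M ->
  (forall x, 0 <= dot x (M *m x)) ->
  forall u v, dot u (M *m v) ^+ 2 <= dot u (M *m u) * dot v (M *m v).
Proof.
move=> symM psdM u v.
have H s t : 0 <= s ^+ 2 * dot u (M *m u) + 2%:R * s * t * dot u (M *m v)
                 + t ^+ 2 * dot v (M *m v).
  have := psdM (s *: u + t *: v).
  rewrite mulmxDr -!scalemxAr !dotDl !dotDr !dotZl !dotZr (dot_sym v u symM).
  by congr (_ <= _); ring.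
have a0 := psdM u; have := psdM v; rewrite le_eqVlt => /orP[/eqP c0|c0].
  (* In the degenerate case [c = 0] this choice of [s] and [t] leaves [- b^2 (a + 2) >= 0], hence
     [b = 0]. *)
  rewrite -c0 mulr0; have := H (dot u (M *m v)) (- dot u (M *m u) - 1).
  rewrite -c0; have := sqr_ge0 (dot u (M *m v)); nra.
rewrite -subr_ge0 -(pmulr_rge0 _ c0).
have := H (dot v (M *m v)) (- dot u (M *m v)).
by congr (_ <= _); ring.
Qed.

Lemma dot_CauchySchwarz n (u v : 'cV[R]_n) : dot u v ^+ 2 <= dot u u * dot v v.
Proof.
have := @psd_CauchySchwarz n 1%:M (trmx1 _ _).
by move/(_ _ u v); rewrite !mul1mx; apply=> x; rewrite mul1mx dot_ge0.
Qed.

(** Invertibility gives [|x|^2 <= c1 |M x|^2]. Cauchy-Schwarz for the form of [M], at [M x] and [x],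
    gives [|M x|^4 <= c2 |M x|^2 (x^T M x)]. This is a spectral gap obtained without diagonalization
    or compactness. *)
Lemma psd_unit_coercive n (M : 'M[R]_n) : M^T = M ->
  (forall x, 0 <= dot x (M *m x)) -> M \in unitmx ->
  exists2 e : R, 0 < e & forall x, e * dot x x <= dot x (M *m x).
Proof.
move=> symM psdM uM.
have [c1 c10 H1] := mulmx_norm_bound (invmx M).
have [c2 c20 H2] := qf_bound M.
exists (c1 * c2)^-1 => [|x]; first by rewrite invr_gt0 mulr_gt0.
have Hx := H1 (M *m x); rewrite mulKmx // in Hx.
rewrite mulrC ler_pdivrMr ?mulr_gt0 //; apply: le_trans Hx _.
have -> : dot x (M *m x) * (c1 * c2) = c1 * (c2 * dot x (M *m x)) by ring.
apply: ler_wpM2l; first exact: ltW.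
have := dot_ge0 (M *m x); rewrite le_eqVlt => /orP[/eqP <-|y0].
  by rewrite mulr_ge0 // ltW.
rewrite -(ler_pM2l y0) -expr2.
have CS := psd_CauchySchwarz symM psdM (M *m x) x.
apply: le_trans CS _; rewrite mulrA (mulrC _ c2); apply: ler_wpM2r => //.
by apply: le_trans (ler_norm _) (H2 _).
Qed.

Lemma posdef_coercive n (M : 'M[R]_n) : M^T = M ->
  (forall x, x != 0 -> 0 < dot x (M *m x)) ->
  exists2 e : R, 0 < e & forall x, e * dot x x <= dot x (M *m x).
Proof.
move=> symM pdM; apply: psd_unit_coercive => // [x|].
  by have [->|/pdM/ltW //] := eqVneq x 0; rewrite dot0l.
rewrite unitmxE unitfE; apply/det0P => -[v v0 vM].
have vT : v^T != 0 by rewrite -(trmx0 _ _ _) (inj_eq trmx_inj).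
have := pdM _ vT; rewrite -{1}symM -trmx_mul vM trmx0 dot0r ltxx //.
Qed.

End QuadraticForms.

(** * Schur stability: decay of powers, Lyapunov equations, certificates *)

Section SchurStable.
Set Implicit Arguments. Unset Strict Implicit.
Variable R : realType.
Implicit Types n m : nat.

Lemma le0_geometric (a C q : R) : 0 < q < 1 ->
  (forall k, a <= C * q ^+ k) -> a <= 0.
Proof.
move=> /andP[q0 q1] aC; rewrite leNgt; apply/negP => a0.
(* This makes [q ^+ k] of order [1 / k], so the archimedean property yields a [k] contradicting
   [0 < a]. *)
have kq k : k%:R * (1 - q) * q ^+ k <= 1 - q ^+ k.
  elim: k => [|k IH]; first by rewrite !mul0r expr0 subrr.
  have Q1 : q ^+ k.+1 <= 1 by rewrite exprn_ile1 // ltW.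
  have := ler_wpM2l (ltW q0) IH.
  have : 0 <= (1 - q) * (1 - q ^+ k.+1) by rewrite mulr_ge0 // subr_ge0 // ltW.
  by rewrite -natr1 exprS; nra.
have C0 : 0 < C by have := aC 0%N; rewrite expr0 mulr1; apply: lt_le_trans.
have d0 : 0 < a * (1 - q) by rewrite mulr_gt0 // subr_gt0.
have := archi_boundP (ltW (divr_gt0 C0 d0)).
set k := Num.bound _; rewrite ltr_pdivrMr // ltNge => /negP; apply.
have qk0 : 0 < q ^+ k by rewrite exprn_gt0.
have : k%:R * (1 - q) * a <= k%:R * (1 - q) * (C * q ^+ k).
  by apply: ler_wpM2l => //; rewrite mulr_ge0 // subr_ge0 ltW.
have := ler_wpM2l (ltW C0) (kq k); have : 0 <= C * q ^+ k by rewrite mulr_ge0 // ltW.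
lra.
Qed.

(** The rate [q'] is at least [q] and strictly above [r], so that even when [r = q] no factor [k]
    appears in the bound. *)
Lemma geometric_recurrence (a : nat -> R) (r q A C : R) :
  0 <= r < 1 -> 0 < q < 1 -> 0 <= A -> 0 <= C -> a 0%N <= A ->
  (forall k, a k.+1 <= r * a k + C * q ^+ k) ->
  let q' := 1 - (1 - q) * (1 - r) / 2%:R in
  forall k, a k <= (A + C / (q' - r)) * q' ^+ k.
Proof.
move=> /andP[r0 r1] /andP[q0 q1] A0 C0 aA ar q'.
have q'r : 0 < q' - r by rewrite /q'; nra.
have q'q : q <= q' by rewrite /q'; nra.
have q'0 : 0 < q' by apply: lt_le_trans q'q.
elim=> [|k IH].
  by rewrite expr0 mulr1; apply: le_trans aA _; rewrite lerDl divr_ge0 // ltW.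
apply: le_trans (ar k) _.
have H1 : r * a k <= r * ((A + C / (q' - r)) * q' ^+ k) by apply: ler_wpM2l.
have H2 : C * q ^+ k <= C * q' ^+ k.
  by apply: ler_wpM2l => //; apply: lerXn2r => //; rewrite nnegrE ltW.
apply: le_trans (lerD H1 H2) _.
have q'k : 0 <= q' ^+ k by rewrite exprn_ge0 // ltW.
rewrite exprS mulrCA !mulrA -mulrDl; apply: ler_wpM2r => //.
have /eqP e : C / (q' - r) * (q' - r) == C by rewrite divfK // gt_eqF.
have : 0 <= A * (q' - r) by rewrite mulr_ge0 // ltW.
move: e; set d := C / _; nra.
Qed.

Local Notation normc := Normc.normc.

(* Peeling the factor M - z off an annihilating product turns decay of
   M^k (M - z) N into the scalar recurrence a_(k+1) <= |z| a_k + C q^k. *)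
Lemma annihilated_decay n (M : 'M[R[i]]_n.+1) (s : seq R[i]) :
  (forall z, z \in s -> normc z < 1) -> forall N : 'M[R[i]]_n.+1,
  horner_mx M (\prod_(z <- s) ('X - z%:P)) *m N = 0 ->
  exists C q : R, [/\ 0 <= C, 0 < q < 1 &
    forall k i j, normc ((M ^+ k *m N) i j) <= C * q ^+ k].
Proof.
elim: s => [|z s IH] Hs N.
  rewrite big_nil rmorph1 mul1mx => ->; exists 0, (2%:R^-1); split => //.
    by lra.
  by move=> k i j; rewrite mulmx0 mxE mul0r Normc.normc0.
rewrite big_cons mulrC rmorphM rmorphB /= horner_mx_X horner_mx_C -mulmxE.
rewrite -mulmxA => /IH[] => [y ys|C [q [C0 q01 HC]]].
  by apply: Hs; rewrite inE ys orbT.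
have r1 : normc z < 1 by apply: Hs; rewrite inE eqxx.
have r0 : 0 <= normc z by case: (z) => ? ?; apply: sqrtr_ge0.
set r := normc z in r1 r0; have r01 : 0 <= r < 1 by rewrite r0.
pose A := \sum_i \sum_j normc (N i j).
have nc0 (y : R[i]) : 0 <= normc y by case: y => ? ?; apply: sqrtr_ge0.
have A0 : 0 <= A by rewrite sumr_ge0 // => i _; rewrite sumr_ge0.
pose q' := 1 - (1 - q) * (1 - r) / 2%:R.
have [q0 q1] := andP q01.
have q'r : 0 < q' - r by rewrite /q'; nra.
have q'01 : 0 < q' < 1 by rewrite /q'; apply/andP; split; nra.
exists (A + C / (q' - r)), q'; split => // [|k i j].
  by rewrite addr_ge0 // divr_ge0 // ltW.
apply: (@geometric_recurrence (fun k => normc ((M ^+ k *m N) i j)) r q) => //.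
- rewrite expr0 mul1mx /A (bigD1 i) //= (bigD1 j) //= -addrA lerDl.
  by rewrite addr_ge0 // sumr_ge0 // => l _; rewrite sumr_ge0.
- move=> l; have -> : M ^+ l.+1 *m N = z *: (M ^+ l *m N) + M ^+ l *m ((M - z%:M) *m N).
    rewrite mulmxBl mulmxBr mul_scalar_mx -scalemxAr exprSr -mulmxE -mulmxA.
    by rewrite addrC subrK.
  rewrite mxE; apply: le_trans (le_normcD _ _) _; apply: lerD => //.
  by rewrite mxE Normc.normcM.
Qed.

(** Over the complex numbers the characteristic polynomial splits with all roots in the open unit
    disc, and by Cayley-Hamilton it annihilates [M]; [annihilated_decay] applies with the identity
    for [N]. *)
Lemma schur_decay n (M : 'M[R]_n) : schur_stable M ->
  exists C q : R, [/\ 0 <= C, 0 < q < 1 &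
    forall k i j, `|(M ^+ k) i j| <= C * q ^+ k].
Proof.
(* The empty matrix is treated apart, since [annihilated_decay] is stated in size [n.+1]. *)
case: n M => [|n] M sM.
  by exists 0, (2%:R^-1); split=> // [|k []//]; lra.
pose Mc := map_mx (real_complex R) M.
have [s Hs] := closed_field_poly_normal (char_poly Mc).
rewrite (monicP (char_poly_monic Mc)) scale1r in Hs.
have [z zs||C [q [C0 q01 HC]]] := @annihilated_decay _ Mc s _ 1%:M.
- by rewrite -ltcR; apply: sM; rewrite Hs root_prod_XsubC.
- by rewrite -Hs Cayley_Hamilton mul0mx.
exists C, q; split => // k i j.
have := HC k i j; rewrite mulmx1 -rmorphXn /= mxE /=.
by rewrite expr0n addr0 sqrtr_sqr.
Qed.

Lemma schur_conj_decay n (M G : 'M[R]_n) : schur_stable M ->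
  exists C q : R, 0 < q < 1 /\
    forall k i j, `|((M ^+ k)^T *m G *m M ^+ k) i j| <= C * q ^+ k.
Proof.
move=> /schur_decay[C [q [C0 q01 HC]]].
have [g g0 Gg] := mx_entries_bounded G.
have [q0 q1] := andP q01.
exists (n%:R * (n%:R * (C * g) * C)), q; split => // k i j.
have qk0 : 0 <= q ^+ k by rewrite exprn_ge0 // ltW.
have qk1 : q ^+ k <= 1 by rewrite exprn_ile1 // ltW.
have H l : `|((M ^+ k)^T *m G) i l| <= n%:R * (C * g).
  rewrite mxE; apply: le_trans (ler_norm_sum _ _ _) _.
  rewrite mulr_natl -[n in leRHS]card_ord -sumr_const; apply: ler_sum => h _.
  rewrite normrM mxE; apply: ler_pM => //.
  by apply: le_trans (HC _ _ _) _; rewrite ler_piMr.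
rewrite mxE; apply: le_trans (ler_norm_sum _ _ _) _.
have -> : n%:R * (n%:R * (C * g) * C) * q ^+ k =
    \sum_(l < n) n%:R * (C * g) * (C * q ^+ k).
  by rewrite sumr_const card_ord -mulr_natl; ring.
by apply: ler_sum => l _; rewrite normrM; apply: ler_pM.
Qed.

(** A fixed point of [X |-> M^T X M] equals all its iterates, and these decay to 0. *)
Lemma schur_lyap_inj n (M X : 'M[R]_n) : schur_stable M ->
  M^T *m X *m M = X -> X = 0.
Proof.
move=> sM HX; have [C [q [q01 HC]]] := schur_conj_decay X sM.
have Hk k : (M ^+ k)^T *m X *m M ^+ k = X.
  elim: k => [|k IH]; first by rewrite expr0 trmx1 mul1mx mulmx1.
  by rewrite exprS -mulmxE trmx_mul -!mulmxA (mulmxA X) (mulmxA M^T) (mulmxA M^T) HX mulmxA.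
apply/matrixP => i j; rewrite mxE; apply/eqP; rewrite -normr_le0.
by apply: (le0_geometric q01) => k; rewrite -(Hk k); apply: HC.
Qed.

Lemma schur_lyap_sym n (M W X : 'M[R]_n) : schur_stable M -> W^T = W ->
  M^T *m X *m M + W = X -> X^T = X.
Proof.
move=> sM symW HX.
have HXT : M^T *m X^T *m M + W = X^T.
  by rewrite -[in RHS]HX linearD /= symW !trmx_mul trmxK mulmxA.
apply/eqP; rewrite -subr_eq0; apply/eqP; apply: (schur_lyap_inj sM).
rewrite mulmxBr mulmxBl.
by rewrite (canRL (addrK _) HX) (canRL (addrK _) HXT) opprB addrA subrK.
Qed.

(** On vectorized matrices the Lyapunov operator is a square matrix; it is injective by
    [schur_lyap_inj], hence invertible. *)
Lemma schur_lyap_solvable n (M W : 'M[R]_n) : schur_stable M ->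
  exists X, M^T *m X *m M + W = X.
Proof.
move=> sM; pose T : 'M_(n * n) := 1%:M - lin_mulmx M^T *m lin_mulmxr M.
have TE X : mxvec X *m T = mxvec (X - M^T *m X *m M).
  by rewrite mulmxBr mulmx1 mulmxA !mul_vec_lin /= linearB.
have : row_free T.
  apply: inj_row_free => v; rewrite -(vec_mxK v) TE => /(congr1 vec_mx).
  rewrite mxvecK linear0 => /eqP; rewrite subr_eq0 eq_sym => /eqP/(schur_lyap_inj sM) ->.
  by rewrite linear0.
rewrite row_free_unit => uT.
exists (vec_mx (mxvec W *m invmx T)); set X := vec_mx _.
have : mxvec X *m T = mxvec W by rewrite vec_mxK mulmxKV.
by rewrite TE => /(can_inj mxvecK) <-; rewrite addrC subrK.
Qed.

(** The value at [x] dominates the values along the orbit [M ^+ k *m x], which tend to 0. This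
    comparison principle turns signs of right-hand sides into signs of Lyapunov solutions. *)
Lemma schur_lyap_ge0 n (M D : 'M[R]_n) : schur_stable M ->
  (forall x, dot (M *m x) (D *m (M *m x)) <= dot x (D *m x)) ->
  forall x, 0 <= dot x (D *m x).
Proof.
move=> sM HD x; have [C [q [q01 HC]]] := schur_conj_decay D sM.
rewrite -oppr_le0.
apply: (@le0_geometric _ (C * n%:R * dot x x) q q01) => k.
have := qf_entry_bound (HC k) x; rewrite ler_norml => /andP[H _].
rewrite lerNl; have -> : - (C * n%:R * dot x x * q ^+ k) = - (C * q ^+ k * n%:R * dot x x) by ring.
apply: le_trans H _; rewrite -!mulmxA -dotMl {HC}.
elim: k => [|k IH]; first by rewrite expr0 mul1mx.
apply: le_trans IH; rewrite exprS -mulmxE -mulmxA; exact: HD.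
Qed.

(** [P] solves the Lyapunov equation with right-hand side the identity. *)
Lemma schur_certificate n (M : 'M[R]_n) : schur_stable M ->
  exists2 P : 'M[R]_n, forall x, 0 <= dot x (P *m x) &
    forall x, dot (M *m x) (P *m (M *m x)) + dot x x = dot x (P *m x).
Proof.
move=> sM; have [P HP] := schur_lyap_solvable 1%:M sM.
have PE x : dot (M *m x) (P *m (M *m x)) + dot x x = dot x (P *m x).
  by rewrite -[in RHS]HP mulmxDl dotDr qf_congr mul1mx.
exists P => //; apply: (schur_lyap_ge0 sM) => x.
by rewrite -[leRHS]PE lerDl dot_ge0.
Qed.

(** [c *: P - V], with [P] the certificate, satisfies the hypothesis of [schur_lyap_ge0]. As [P]
    depends on [M] only, the bound is uniform in [V] and [c]. *)
Lemma schur_lyap_bound n (M : 'M[R]_n) : schur_stable M ->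
  exists2 P : 'M[R]_n, forall x, 0 <= dot x (P *m x) &
    forall (V : 'M[R]_n) c,
      (forall x, dot x (V *m x) <= dot (M *m x) (V *m (M *m x)) + c * dot x x) ->
      forall x, dot x (V *m x) <= c * dot x (P *m x).
Proof.
move=> sM; have [P P0 PE] := schur_certificate sM; exists P => // V c HV x.
have VE y : dot y ((c *: P - V) *m y) = c * dot y (P *m y) - dot y (V *m y).
  by rewrite mulmxBl -scalemxAl dotDr dotNr dotZr.
rewrite -subr_ge0 -VE; apply: (schur_lyap_ge0 sM) => y.
by rewrite !VE -(PE y) mulrDr; have := HV y; lra.
Qed.

(** A complex eigenvector [x + i y] for [a + i b] amounts to the two real equations on [x] and [y],
    so that stability can be tested with real quadratic forms. *)
Lemma schur_of_no_unstable_plane n (M : 'M[R]_n) :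
  (forall (a b : R) (x y : 'cV[R]_n), 1 <= a ^+ 2 + b ^+ 2 ->
     M *m x = a *: x - b *: y -> M *m y = b *: x + a *: y -> x = 0 /\ y = 0) ->
  schur_stable M.
Proof.
move=> H z rz; pose Mc := map_mx (real_complex R) M.
(* [eigenvalue] speaks of row vectors; the transpose supplies a column eigenvector. *)
have : \det (z%:M - Mc)^T == 0.
  move: rz; rewrite -eigenvalue_root_char => /eigenvalueP[v Hv v0].
  rewrite det_tr; apply/det0P; exists v => //.
  by rewrite mulmxBr Hv mul_mx_scalar subrr.
move/det0P => [v v0]; rewrite linearB /= tr_scalar_mx mulmxBr mul_mx_scalar.
move/eqP; rewrite subr_eq0 => /eqP Hv.
pose x : 'cV[R]_n := \col_i complex.Re (v 0 i).
pose y : 'cV[R]_n := \col_i complex.Im (v 0 i).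
have E i : z * v 0 i = \sum_j v 0 j * (M i j)%:C%C.
  have := congr1 (fun w : 'rV_n => w 0 i) Hv; rewrite !mxE => ->.
  by apply: eq_bigr => j _; rewrite !mxE.
have sumRI (F : 'I_n -> R[i]) : complex.Re (\sum_j F j) = \sum_j complex.Re (F j)
    /\ complex.Im (\sum_j F j) = \sum_j complex.Im (F j).
  by rewrite !raddf_sum.
have EE i : (M *m x) i 0 = complex.Re (z * v 0 i)
         /\ (M *m y) i 0 = complex.Im (z * v 0 i).
  rewrite E !mxE; have [-> ->] := sumRI (fun j => v 0 j * (M i j)%:C%C).
  by split; apply: eq_bigr => j _; rewrite !mxE; case: (v 0 j) => p q /=; ring.
rewrite real_ltNge ?normr_real ?real1 //; apply/negP => z1.
have [||| x0 y0] := H (complex.Re z) (complex.Im z) x y.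
- move: z1; rewrite -(@ler_pXn2r _ 2%N) ?nnegrE // -add_Re2_Im2 expr1n.
  by rewrite -[1](rmorph1 (real_complex R)) lecR.
- apply/colP => i; have [-> _] := EE i; rewrite !mxE.
  by case: (z) => ? ?; case: (v 0 i).
- apply/colP => i; have [_ ->] := EE i; rewrite !mxE.
  by case: (z) => ? ?; case: (v 0 i) => ? ? /=; ring.
case/eqP: v0; apply/rowP => i; rewrite mxE.
have := congr1 (fun w : 'cV_n => w i 0) x0; have := congr1 (fun w : 'cV_n => w i 0) y0.
by rewrite !mxE; case: (v 0 i) => p q /= -> ->.
Qed.

(** The sum is the real part of the Hermitian form of [P] at [x + i y], which multiplication by
    [a + i b] scales by the squared modulus: the cross terms cancel. *)
Lemma unstable_plane_qf n (M P : 'M[R]_n) a b x y :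
  M *m x = a *: x - b *: y -> M *m y = b *: x + a *: y ->
  dot (M *m x) (P *m (M *m x)) + dot (M *m y) (P *m (M *m y)) =
  (a ^+ 2 + b ^+ 2) * (dot x (P *m x) + dot y (P *m y)).
Proof.
move=> -> ->; rewrite !mulmxDr !mulmxN -!scalemxAr.
by rewrite !(dotDl, dotDr, dotNl, dotNr, dotZl, dotZr); ring.
Qed.

Lemma schur_no_unstable_plane n (M : 'M[R]_n) : schur_stable M ->
  forall (a b : R) (x y : 'cV[R]_n), 1 <= a ^+ 2 + b ^+ 2 ->
  M *m x = a *: x - b *: y -> M *m y = b *: x + a *: y -> x = 0 /\ y = 0.
Proof.
move=> sM a b x y ab1 Hx Hy.
have [P P0 PE] := schur_certificate sM.
have := unstable_plane_qf P Hx Hy.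
have := PE x; have := PE y; have := P0 x; have := P0 y.
have := dot_ge0 x; have := dot_ge0 y => y0 x0 Py Px Ey Ex H.
have s0 : dot x x + dot y y <= 0 by nra.
by split; apply: dot_eq0; lra.
Qed.

Lemma schur_of_lyap n (M P : 'M[R]_n) :
  (forall x, 0 <= dot x (P *m x)) ->
  (forall x, x != 0 -> dot (M *m x) (P *m (M *m x)) < dot x (P *m x)) ->
  schur_stable M.
Proof.
move=> P0 HP; apply: schur_of_no_unstable_plane => a b x y ab1 Hx Hy.
have HP' u : dot (M *m u) (P *m (M *m u)) <= dot u (P *m u).
  by have [->|/HP/ltW//] := eqVneq u 0; rewrite mulmx0 dot0l.
have H := unstable_plane_qf P Hx Hy.
have := P0 x; have := P0 y; have := HP' x; have := HP' y => hy hx py px.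
have [x0|/HP hx'] := eqVneq x 0; have [y0|/HP hy'] := eqVneq y 0 => //.
- by exfalso; nra.
- by exfalso; nra.
- by exfalso; nra.
Qed.

(** The certificate of [M] still decreases along [M + t *: N]: its margin [|x|^2] absorbs the terms
    of order [t] and [t^2]. The minimum with 1 in [t0] serves to bound [t^2] by [t]. *)
Lemma schur_perturb n (M N : 'M[R]_n) : schur_stable M ->
  exists2 t0 : R, 0 < t0 & forall t, 0 < t < t0 -> schur_stable (M + t *: N).
Proof.
move=> sM; have [P P0 PE] := schur_certificate sM.
have [c c0 Hc] := qf_bound (M^T *m P *m N + N^T *m P *m M).
have [d d0 Hd] := qf_bound (N^T *m P *m N).
exists (Num.min 1 (c + d)^-1) => [|t /andP[t0]].
  by rewrite lt_min ltr01 invr_gt0 addr_gt0.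
rewrite lt_min => /andP[t1 tcd].
have {}tcd : t * (c + d) < 1 by rewrite -ltr_pdivlMr ?addr_gt0 // div1r.
apply: (schur_of_lyap P0) => x x0.
have := Hc x; have := Hd x; have := PE x; have := dot_gt0 x0.
rewrite !mulmxDl -!scalemxAl !mulmxDr -!scalemxAr.
rewrite !(dotDl, dotDr, dotZl, dotZr).
rewrite -!mulmxA -!dotMl !ler_norml.
move=> xx E /andP[_ H1] /andP[_ H2]; rewrite -E.
set u := dot (M *m x) (P *m (N *m x)) in H2 *.
set v := dot (N *m x) (P *m (M *m x)) in H2 *.
set w := dot (N *m x) _ in H1 *.
have h1 : t * (u + v) <= t * (c * dot x x) by rewrite ler_pM2l.
have h2 : t * (t * w) <= t * (d * dot x x).
  rewrite ler_pM2l //; have : 0 <= d * dot x x by rewrite mulr_ge0 // ltW.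
  nra.
have h3 : t * (c + d) * dot x x < dot x x by rewrite gtr_pMl.
nra.
Qed.

End SchurStable.

(** * The largest eigenvalue of a symmetric matrix *)

Section LargestEigenvalue.
Set Implicit Arguments. Unset Strict Implicit.
Variable R : realType.

(** Take for [mu] the least [c] such that [c I - H] is positive semidefinite. Were [mu I - H]
    invertible, it would be coercive and a smaller [c] would do; so it is singular. *)
Lemma symmetric_max_eigenvalue m (H : 'M[R]_m) : (0 < m)%N -> H^T = H ->
  exists2 mu : R, eigenvalue H mu &
    forall v, dot v (H *m v) <= mu * dot v v.
Proof.
move=> m0 symH.
pose S : R -> Prop := fun c => forall v, dot v (H *m v) <= c * dot v v.
(* A nonzero vector, whose Rayleigh quotient bounds [S] below. *)
pose e : 'cV[R]_m := const_mx 1.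
have e0 : e != 0.
  by apply/eqP => /(congr1 (fun w : 'cV_m => w (Ordinal m0) 0)) /eqP; rewrite !mxE oner_eq0.
have Sne : exists c, S c.
  by have [c _ Hc] := qf_bound H; exists c => v; apply: le_trans (ler_norm _) (Hc v).
have quot v c : v != 0 -> S c -> dot v (H *m v) / dot v v <= c.
  by move=> v0 Sc; rewrite ler_pdivrMr ?dot_gt0.
have muS : S (inf S).
  move=> v; have [->|v0] := eqVneq v 0; first by rewrite !dot0l mulr0.
  rewrite -ler_pdivrMr ?dot_gt0 //; apply: lb_le_inf => // c; exact: quot.
exists (inf S) => //.
pose M := (inf S)%:M - H.
have ME v : dot v (M *m v) = inf S * dot v v - dot v (H *m v).
  by rewrite mulmxBl mul_scalar_mx dotDr dotNr dotZr.
have symM : M^T = M by rewrite linearB /= tr_scalar_mx symH.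
have psdM v : 0 <= dot v (M *m v) by rewrite ME subr_ge0.
have [uM|] := boolP (M \in unitmx).
  have [d d0 Hd] := psd_unit_coercive symM psdM uM; exfalso.
  have Sd : S (inf S - d).
    by move=> v; have := Hd v; rewrite ME mulrBl; lra.
  have : inf S <= inf S - d.
    by apply: ge_inf => //; exists (dot e (H *m e) / dot e e) => c; apply: quot.
  lra.
rewrite unitmxE unitfE negbK => /det0P[v v0]; rewrite mulmxBr mul_mx_scalar.
move/eqP; rewrite subr_eq0 => /eqP Hv.
by apply/eigenvalueP; exists v.
Qed.

Lemma eigenvalue_qf m (H : 'M[R]_m) a : H^T = H -> eigenvalue H a ->
  exists2 v : 'cV[R]_m, v != 0 & dot v (H *m v) = a * dot v v.
Proof.
move=> symH /eigenvalueP[v Hv v0]; exists v^T.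
  by apply: contraNneq v0 => /(congr1 trmx); rewrite trmxK trmx0 => ->.
by rewrite -[in LHS]symH -trmx_mul Hv linearZ dotZr.
Qed.

Lemma lam_maxP m (H : 'M[R]_m) : (0 < m)%N -> H^T = H ->
  eigenvalue H (lam_max H) /\
  forall v, dot v (H *m v) <= lam_max H * dot v v.
Proof.
move=> m0 symH; have [mu emu Hmu] := symmetric_max_eigenvalue m0 symH.
suff -> : lam_max H = mu by [].
have ub a : eigenvalue H a -> a <= mu.
  move=> /(eigenvalue_qf symH)[v v0 Hv].
  by have := Hmu v; rewrite Hv ler_pM2r // dot_gt0.
apply/le_anti/andP; split.
  by apply: ge_sup; [exists mu | move=> a; apply: ub].
by apply: ub_le_sup => //; exists mu => a; apply: ub.
Qed.

End LargestEigenvalue.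

(** * Coercivity provided by the spanning set *)

Section SpanningSet.
Set Implicit Arguments. Unset Strict Implicit.
Variables (R : realType) (n : nat) (z : 'I_n -> 'cV[R]_n).

Lemma trace_Sigma (X : 'M[R]_n) : \tr (X *m Sigma z) = \sum_i dot (z i) (X *m z i).
Proof.
rewrite /Sigma mulmx_sumr raddf_sum; apply: eq_bigr => i _.
by rewrite /= mulmxA mxtrace_mulC /dot /mxtrace big_ord1.
Qed.

(** The matrix with rows [(z i)^T] is invertible, and the right-hand side is the squared norm of its
    product with [w]. *)
Lemma spanning_coercive : spanning z ->
  exists2 s : R, 0 < s & forall w, s * dot w w <= \sum_i dot (z i) w ^+ 2.
Proof.
rewrite /spanning; set Z := \matrix_(i, j) _; rewrite row_full_unit => uZ.
have [c c0 Hc] := mulmx_norm_bound (invmx Z).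
exists c^-1 => [|w]; first by rewrite invr_gt0.
rewrite mulrC ler_pdivrMr // mulrC; have := Hc (Z *m w); rewrite mulKmx //.
congr (_ <= _ * _); rewrite [LHS]dotE; apply: eq_bigr => i _; rewrite -expr2.
by congr (_ ^+ 2); rewrite mxE dotE; apply: eq_bigr => j _; rewrite mxE.
Qed.

(** [spanning_coercive] is applied to each row of [D]. This recovers Frobenius norms from traces
    against [Sigma z]. *)
Lemma spanning_frob2 : spanning z ->
  exists2 s : R, 0 < s & forall m (D : 'M[R]_(m, n)),
    s * frob2 D <= \sum_i dot (D *m z i) (D *m z i).
Proof.
move=> /spanning_coercive[s s0 Hs]; exists s => // m D.
have -> : \sum_i dot (D *m z i) (D *m z i) =
    \sum_k \sum_i dot (z i) (row k D)^T ^+ 2.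
  rewrite exchange_big; apply: eq_bigr => i _; rewrite dotE.
  apply: eq_bigr => k _; rewrite -expr2; congr (_ ^+ 2).
  by rewrite mxE dotE; apply: eq_bigr => j _; rewrite !mxE mulrC.
rewrite /frob2 mulr_sumr; apply: ler_sum => k _.
apply: le_trans (Hs _); rewrite dotE.
by under [in leRHS]eq_bigr => j _ do rewrite !mxE -expr2.
Qed.

End SpanningSet.

(** * The squared Frobenius norm *)

Section Frobenius.
Set Implicit Arguments. Unset Strict Implicit.
Variables (R : realType) (n m : nat).
Implicit Type D : 'M[R]_(m, n).

Lemma frob2_ge0 D : 0 <= frob2 D.
Proof. by rewrite /frob2 sumr_ge0 // => i _; rewrite sumr_ge0 // => j _; apply: sqr_ge0. Qed.

Lemma frob2_gt0 D : D != 0 -> 0 < frob2 D.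
Proof.
move=> D0; rewrite lt_neqAle frob2_ge0 andbT; apply: contraNneq D0 => D0.
apply/eqP/matrixP => i j; rewrite mxE; apply/eqP; rewrite -sqrf_eq0.
have rows k : 0 <= \sum_j D k j ^+ 2 by rewrite sumr_ge0 // => l _; apply: sqr_ge0.
have /psumr_eq0P/(_ i isT) : \sum_i \sum_j D i j ^+ 2 = 0 by [].
move=> /(_ (fun k _ => rows k)).
by move/psumr_eq0P => -> // l _; apply: sqr_ge0.
Qed.

Lemma frob2Z a D : frob2 (a *: D) = a ^+ 2 * frob2 D.
Proof.
rewrite /frob2 mulr_sumr; apply: eq_bigr => i _; rewrite mulr_sumr.
by apply: eq_bigr => j _; rewrite mxE exprMn.
Qed.

Lemma mulmx_frob2 D x : dot (D *m x) (D *m x) <= frob2 D * dot x x.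
Proof.
rewrite dotE /frob2 mulr_suml; apply: ler_sum => k _; rewrite -expr2.
have -> : (D *m x) k 0 = dot (row k D)^T x.
  by rewrite mxE dotE; apply: eq_bigr => j _; rewrite !mxE.
apply: le_trans (dot_CauchySchwarz _ _) _; rewrite [X in X * _ <= _]dotE.
by under eq_bigr => j _ do rewrite !mxE -expr2.
Qed.

End Frobenius.

(** * Change of [X_K] under a change of gain *)

Section PolicyGradient.
Set Implicit Arguments. Unset Strict Implicit.
Variables (R : realType) (n m : nat).
Variables (A : 'M[R]_n) (B : 'M[R]_(n, m)) (Q : 'M[R]_n) (Rm : 'M[R]_m).
Hypotheses (symQ : Q^T = Q) (symR : Rm^T = Rm).

Local Notation X := (XK A B Q Rm).
Local Notation stab := (stabilizing A B).
Local Notation E K := (Rm *m K - B^T *m X K *m (A - B *m K)).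
Local Notation H K := (Rm + B^T *m X K *m B).

(** Solvability excludes the default value 0 in [XK]. *)
Lemma XK_lyap K : stab K -> lyap_eq A B Q Rm K (X K).
Proof.
move=> sK; rewrite /XK; case: pselect => [e|[]]; first exact: projT2 (cid e).
have [Y HY] := schur_lyap_solvable (Q + K^T *m Rm *m K) sK.
by exists Y; rewrite /lyap_eq -addrA.
Qed.

Lemma XK_sym K : stab K -> (X K)^T = X K.
Proof.
move=> sK; have := XK_lyap sK; rewrite /lyap_eq -addrA; apply: schur_lyap_sym => //.
by rewrite linearD /= !trmx_mul trmxK symQ symR mulmxA.
Qed.

Lemma hess_sym K : stab K -> (H K)^T = H K.
Proof. by move=> sK; rewrite linearD /= !trmx_mul trmxK XK_sym // symR mulmxA. Qed.

Lemma hess_qf K v : dot v (H K *m v) = dot v (Rm *m v) + dot (B *m v) (X K *m (B *m v)).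
Proof. by rewrite mulmxDl dotDr [in RHS]dotMl !mulmxA. Qed.

Lemma XK_qf K x : stab K ->
  dot ((A - B *m K) *m x) (X K *m ((A - B *m K) *m x)) + dot x (Q *m x)
    + dot (K *m x) (Rm *m (K *m x)) = dot x (X K *m x).
Proof.
move=> /XK_lyap HX; by rewrite -[in RHS]HX mulmxDl dotDr qf_congr mulmxDl dotDr qf_congr.
Qed.

Local Notation gain K D x :=
  (2%:R * dot (D *m x) (E K *m x) + dot (D *m x) (H K *m (D *m x))).

(** A purely algebraic expansion around [K]: it holds whether or not [K + D] is stabilizing, so it
    can serve to prove that a step stays in the stabilizing set. *)
Lemma XK_shift K D x : stab K ->
  let x' := (A - B *m (K + D)) *m x in
  dot x' (X K *m x') + dot x (Q *m x)
    + dot ((K + D) *m x) (Rm *m ((K + D) *m x)) = dot x (X K *m x) + gain K D x.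
Proof.
move=> sK x'; rewrite -(XK_qf x sK).
pose u := (A - B *m K) *m x; pose w := B *m (D *m x); pose d := D *m x.
have x'E : x' = u - w.
  by rewrite /x' mulmxDr opprD addrA mulmxBl -!mulmxA.
have qfX : dot x' (X K *m x') =
    dot u (X K *m u) - 2%:R * dot w (X K *m u) + dot w (X K *m w).
  rewrite x'E mulmxBr !(dotDl, dotDr, dotNl, dotNr).
  by rewrite (dot_sym u w (XK_sym sK)); ring.
have qfR : dot ((K + D) *m x) (Rm *m ((K + D) *m x)) =
    dot (K *m x) (Rm *m (K *m x)) + 2%:R * dot d (Rm *m (K *m x)) + dot d (Rm *m d).
  rewrite mulmxDl mulmxDr !(dotDl, dotDr).
  by rewrite (dot_sym (K *m x) _ symR) -/d; ring.
have EE : dot d (E K *m x) = dot d (Rm *m (K *m x)) - dot w (X K *m u).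
  by rewrite mulmxBl dotDr dotNr /w dotMl -/d /u !mulmxA.
rewrite hess_qf -/d -/w -/u EE qfR qfX; ring.
Qed.

Lemma XK_diff K D : stab K -> stab (K + D) -> forall x,
  let V := X (K + D) - X K in let x' := (A - B *m (K + D)) *m x in
  dot x (V *m x) = dot x' (V *m x') + gain K D x.
Proof.
move=> sK sKD x V x'; rewrite /V !(mulmxBl (X (K + D))) !dotDr !dotNr.
by have := XK_shift D x sK; have := XK_qf x sKD; rewrite /= -/x'; lra.
Qed.

(** The comparison principle gives [V <= 0] for the difference [V]; one more step of its Lyapunov
    equation retains the gain at [x]. *)
Lemma XK_le K D x : stab K -> stab (K + D) -> (forall y, gain K D y <= 0) ->
  dot x (X (K + D) *m x) <= dot x (X K *m x) + gain K D x.
Proof.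
move=> sK sKD g0.
have HV := XK_diff sK sKD.
have : 0 <= dot ((A - B *m (K + D)) *m x) (- (X (K + D) - X K) *m ((A - B *m (K + D)) *m x)).
  apply: (schur_lyap_ge0 sKD) => y.
  by rewrite !mulNmx !dotNr lerN2 [in leLHS](HV y) gerDl.
have := HV x => /=; rewrite mulNmx dotNr mulmxBl dotDr dotNr; lra.
Qed.

Lemma XK_ge K D x : stab K -> stab (K + D) -> (forall y, 0 <= gain K D y) ->
  dot x (X K *m x) + gain K D x <= dot x (X (K + D) *m x).
Proof.
move=> sK sKD g0.
have HV := XK_diff sK sKD.
have : 0 <= dot ((A - B *m (K + D)) *m x) ((X (K + D) - X K) *m ((A - B *m (K + D)) *m x)).
  apply: (schur_lyap_ge0 sKD) => y.
  by rewrite [in leRHS](HV y) lerDl.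
have := HV x => /=; rewrite [_ *m x in LHS]mulmxBl dotDr dotNr; lra.
Qed.

(** * First- and second-order conditions at the strict local minimizer *)

Section LocalMinimizer.
Variables (z : 'I_n -> 'cV[R]_n) (Ks : 'M[R]_(m, n)).
Hypotheses (n0 : (0 < n)%N) (spanz : spanning z) (sKs : stab Ks).
Hypothesis locmin : exists delta : R, 0 < delta /\
  forall K : 'M[R]_(m, n), stab K ->
    0 < frob (K - Ks) -> frob (K - Ks) < delta ->
    cost A B Q Rm z Ks < cost A B Q Rm z K.

Local Notation f := (cost A B Q Rm z).

(** By [XK_le] a nonpositive gain would not raise the cost at stabilizing gains arbitrarily near
    [Ks], against strictness. *)
Lemma locmin_direction (D : 'M[R]_(m, n)) (t1 : R) : D != 0 -> 0 < t1 ->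
  (forall t, 0 < t < t1 -> forall x, gain Ks (t *: D) x <= 0) -> False.
Proof.
move=> D0 t10 Hg; have [d [d0 Hd]] := locmin.
have [t2 t20 Ht2] := schur_perturb (- (B *m D)) sKs.
have F0 := frob2_gt0 D0.
have FD0 : 0 < frob D by rewrite sqrtr_gt0.
(* Half of the minimum meets three constraints: sign of the gain, stability, distance to [Ks]. *)
pose t := Num.min t1 (Num.min t2 (d / frob D)) / 2%:R.
have mpos : 0 < Num.min t1 (Num.min t2 (d / frob D)).
  by rewrite !lt_min t10 t20 divr_gt0.
have t0 : 0 < t by rewrite divr_gt0.
have : t < Num.min t1 (Num.min t2 (d / frob D)).
  by rewrite /t ltr_pdivrMr // ltr_pMr // ltr1n.
rewrite !lt_min => /and3P[tt1 tt2 td].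
have sKD : stab (Ks + t *: D).
  rewrite /stabilizing mulmxDr opprD addrA -scalemxAr -scalerN.
  by apply: Ht2; rewrite t0.
have fE : frob (Ks + t *: D - Ks) = t * frob D.
  by rewrite addrC addKr /frob frob2Z sqrtrM ?sqr_ge0 // sqrtr_sqr gtr0_norm.
have := Hd _ sKD; rewrite fE mulr_gt0 // -ltr_pdivlMr // => /(_ isT td).
rewrite ltNge => /negP; apply; rewrite /cost !trace_Sigma; apply: ler_sum => i _.
have g0 := Hg t; rewrite t0 tt1 in g0.
apply: le_trans (XK_le (z i) sKs sKD (g0 isT)) _.
by rewrite gerDl g0.
Qed.

Lemma locmin_grad0 : E Ks = 0.
Proof.
apply: contrapT => /eqP E0.
have [c c0 Hc] := qf_bound (H Ks).
apply: (@locmin_direction (- E Ks) (2%:R / c)); rewrite ?oppr_eq0 ?divr_gt0 //.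
(* The gain is at most [t (t c - 2) |E x|^2], whence the threshold [2 / c]. *)
move=> t /andP[t0]; rewrite ltr_pdivlMr // => tc x.
rewrite -scalemxAl mulNmx scalerN !(dotNl, dotZl) mulmxN -scalemxAr !(dotNr, dotZr).
have := Hc (E Ks *m x); rewrite ler_norml => /andP[_].
have := dot_ge0 (E Ks *m x).
set e := dot _ _; set h := dot (E Ks *m x) (H Ks *m (E Ks *m x)) => e0 he.
have : t * (t * h) <= t * (2%:R * e).
  rewrite ler_pM2l //; have := ler_wpM2l (ltW t0) he; nra.
lra.
Qed.

Lemma locmin_posdef v : v != 0 -> 0 < dot v (H Ks *m v).
Proof.
move=> v0; rewrite ltNge; apply/negP => Hv.
(* A rank-one direction, nonzero as [n] is positive; every [D *m x] is a multiple of [v]. *)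
pose D : 'M[R]_(m, n) := v *m (const_mx 1 : 'rV_n).
have D0 : D != 0.
  apply: contraNneq v0 => /matrixP D0; apply/eqP/colP => i.
  by have := D0 i (Ordinal n0); rewrite !mxE big_ord1 mxE mulr1.
apply: (@locmin_direction D 1) => // t _ x.
have -> : t *: D *m x = (t * ((const_mx 1 : 'rV_n) *m x) 0 0) *: v.
  rewrite -scalemxAl -scalerA -mulmxA; congr (_ *: _).
  by rewrite [X in _ *m X]mx11_scalar mul_mx_scalar.
rewrite locmin_grad0 mul0mx dot0r mulr0 add0r -scalemxAr dotZl dotZr mulrA -expr2.
by rewrite mulr_ge0_le0 // sqr_ge0.
Qed.

Lemma locmin_gain D x : gain Ks D x = dot (D *m x) (H Ks *m (D *m x)).
Proof. by rewrite locmin_grad0 mul0mx dot0r mulr0 add0r. Qed.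

(** The gain from [Ks] has no linear term and a positive quadratic one, for steps of any size; thus
    local optimality becomes global. *)
Lemma XK_minimal K x : stab K ->
  dot x (X Ks *m x) + dot ((K - Ks) *m x) (H Ks *m ((K - Ks) *m x)) <= dot x (X K *m x).
Proof.
move=> sK; rewrite -locmin_gain.
have KE : Ks + (K - Ks) = K by rewrite addrC subrK.
rewrite -[in leRHS]KE; apply: XK_ge; rewrite ?KE // => y; rewrite locmin_gain.
by have [->|/locmin_posdef/ltW//] := eqVneq ((K - Ks) *m y) 0; rewrite dot0l.
Qed.

(** The difference of the two Hessians is [B^T (X_K - X_Ks) B]. *)
Lemma hess_minimal K v : stab K -> dot v (H Ks *m v) <= dot v (H K *m v).
Proof.
move=> sK; rewrite !hess_qf lerD2l; apply: le_trans (XK_minimal _ sK); rewrite lerDl.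
set w := _ *m _.
by have [->|/locmin_posdef/ltW//] := eqVneq w 0; rewrite dot0l.
Qed.

(** * The natural gradient step: descent and stability *)

Hypothesis m0 : (0 < m)%N.

Lemma lam_max_gt0 K : stab K -> 0 < lam_max (H K).
Proof.
move=> sK; have [/(eigenvalue_qf (hess_sym sK))[v v0 Hv] _] := lam_maxP m0 (hess_sym sK).
rewrite -(pmulr_lgt0 _ (dot_gt0 v0)) -Hv.
by apply: lt_le_trans (hess_minimal v sK); apply: locmin_posdef.
Qed.

(** Serves to bound the stepsizes below along the iteration, where [X_K] decreases. *)
Lemma lam_max_mono K K' : stab K -> stab K' ->
  (forall x, dot x (X K *m x) <= dot x (X K' *m x)) ->
  lam_max (H K) <= lam_max (H K').
Proof.
move=> sK sK' le_X.
have [/(eigenvalue_qf (hess_sym sK))[v v0 Hv] _] := lam_maxP m0 (hess_sym sK).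
have [_ /(_ v)] := lam_maxP m0 (hess_sym sK').
have : dot v (H K *m v) <= dot v (H K' *m v) by rewrite !hess_qf lerD2l.
rewrite Hv; move: (lam_max _) (lam_max _) => l l' /le_trans/[apply].
by rewrite ler_pM2r // dot_gt0.
Qed.

(** The increment of the iteration, the factor 2 of [nat_grad] being cancelled by that of
    [stepsize]. *)
Definition ng_step K : 'M[R]_(m, n) := - ((lam_max (H K))^-1 *: E K).

Lemma ng_iterS K0 j : ng_iter A B Q Rm K0 j.+1 =
  ng_iter A B Q Rm K0 j + ng_step (ng_iter A B Q Rm K0 j).
Proof.
rewrite /= /stepsize /nat_grad /ng_step scalerA; congr (_ - _ *: _).
by rewrite div1r invfM mulrAC mulVf ?mul1r // pnatr_eq0.
Qed.

(** For a step [- t E] the gain is at most [(- 2 t + t^2 lambda) |E x|^2], and [t = 1 / lambda]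
    minimizes this bound. *)
Lemma ng_step_gain K x : stab K ->
  gain K (ng_step K) x <= - ((lam_max (H K))^-1 * dot (E K *m x) (E K *m x)).
Proof.
move=> sK; have [_ /(_ (E K *m x)) Hub] := lam_maxP m0 (hess_sym sK).
have l0 := lam_max_gt0 sK; have il0 : 0 < (lam_max (H K))^-1 by rewrite invr_gt0.
rewrite /ng_step mulNmx -scalemxAl mulmxN -scalemxAr.
rewrite !(dotNl, dotNr, dotZl, dotZr) opprK.
have : (lam_max (H K))^-1 * dot (E K *m x) (H K *m (E K *m x)) <=
    dot (E K *m x) (E K *m x) by rewrite mulrC ler_pdivrMr // mulrC.
by move/(ler_wpM2l (ltW il0)); lra.
Qed.

(* X K - X Ks is a Lyapunov function for the new closed loop up to the directions
   killed by K + ng_step K - Ks, on which the new closed loop is that of Ks. *)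
Lemma ng_step_stabilizing K : stab K -> stab (K + ng_step K).
Proof.
move=> sK; set K' := K + ng_step K; pose V := X K - X Ks; pose D := K' - Ks.
have VE x : dot x (V *m x) = dot x (X K *m x) - dot x (X Ks *m x).
  by rewrite mulmxBl dotDr dotNr.
have HD0 x : 0 <= dot (D *m x) (H Ks *m (D *m x)).
  by have [->|/locmin_posdef/ltW//] := eqVneq (D *m x) 0; rewrite dot0l.
have V0 x : 0 <= dot x (V *m x).
  rewrite VE subr_ge0; apply: le_trans (XK_minimal x sK); rewrite lerDl.
  by have [->|/locmin_posdef/ltW//] := eqVneq ((K - Ks) *m x) 0; rewrite dot0l.
(* The shift identities from [K] and from [Ks] to [K'] share the running cost, which cancels in
   their difference. *)
have dV x : dot ((A - B *m K') *m x) (V *m ((A - B *m K') *m x)) +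
    dot (D *m x) (H Ks *m (D *m x)) <= dot x (V *m x).
  rewrite !VE; have := XK_shift (ng_step K) x sK.
  have := XK_shift D x sKs; rewrite locmin_gain.
  have -> : Ks + D = K' by rewrite addrC subrK.
  have := ng_step_gain x sK.
  have : 0 <= (lam_max (H K))^-1 * dot (E K *m x) (E K *m x).
    by rewrite mulr_ge0 ?dot_ge0 // invr_ge0 ltW // lam_max_gt0.
  by rewrite /= -/K'; lra.
apply: schur_of_no_unstable_plane => a b x y ab1 Hx Hy.
have HV := unstable_plane_qf V Hx Hy.
have : dot (D *m x) (H Ks *m (D *m x)) + dot (D *m y) (H Ks *m (D *m y)) <= 0.
  have := dV x; have := dV y; have := V0 x; have := V0 y; move: HV.
  set p := dot x _; set q := dot y _ => HV q0 p0.
  have : 0 <= (a ^+ 2 + b ^+ 2 - 1) * (p + q) by rewrite mulr_ge0 ?subr_ge0 ?addr_ge0.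
  lra.
move=> HD; have Dx : D *m x = 0.
  apply: contrapT => /eqP/locmin_posdef; have := HD0 y; lra.
have Dy : D *m y = 0.
  apply: contrapT => /eqP/locmin_posdef; have := HD0 x; lra.
have loopE u : D *m u = 0 -> (A - B *m Ks) *m u = (A - B *m K') *m u.
  have -> : K' = Ks + D by rewrite addrC subrK.
  by move=> Du; rewrite mulmxDr opprD addrA [RHS]mulmxBl -[B *m D *m u]mulmxA Du mulmx0 subr0.
by apply: (schur_no_unstable_plane sKs ab1); rewrite loopE.
Qed.

Lemma XK_ng_step K x : stab K ->
  dot x (X (K + ng_step K) *m x) <=
  dot x (X K *m x) - (lam_max (H K))^-1 * dot (E K *m x) (E K *m x).
Proof.
move=> sK; have g y := ng_step_gain y sK.
apply: le_trans (XK_le x sK (ng_step_stabilizing sK) _) _ => [y|].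
  apply: le_trans (g y) _; rewrite oppr_le0.
  by rewrite mulr_ge0 ?dot_ge0 // invr_ge0 ltW // lam_max_gt0.
by rewrite lerD2l.
Qed.

Lemma ng_iter_invariant K0 j : stab K0 ->
  stab (ng_iter A B Q Rm K0 j) /\
  forall x, dot x (X (ng_iter A B Q Rm K0 j) *m x) <= dot x (X K0 *m x).
Proof.
move=> sK0; elim: j => [|j [sKj le_X]]; first by [].
rewrite ng_iterS; split; first exact: ng_step_stabilizing.
move=> x; apply: le_trans (XK_ng_step x sKj) _; apply: le_trans (le_X x).
by rewrite gerBl mulr_ge0 ?dot_ge0 // invr_ge0 ltW // lam_max_gt0.
Qed.

(** * Quadratic growth, gradient dominance and the linear rate *)

Lemma hess_coercive : exists2 h : R, 0 < h & forall v, h * dot v v <= dot v (H Ks *m v).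
Proof. exact: posdef_coercive (hess_sym sKs) locmin_posdef. Qed.

Lemma cost_quadratic_growth : exists2 g : R, 0 < g &
  forall K, stab K -> g * frob2 (K - Ks) <= f K - f Ks.
Proof.
have [h h0 Hh] := hess_coercive; have [s s0 Hs] := spanning_frob2 spanz.
exists (h * s) => [|K sK]; first exact: mulr_gt0.
rewrite /cost !trace_Sigma -sumrB -mulrA.
apply: le_trans (ler_wpM2l (ltW h0) (Hs _ (K - Ks))) _.
rewrite mulr_sumr; apply: ler_sum => i _.
have := XK_minimal (z i) sK; have := Hh ((K - Ks) *m z i); lra.
Qed.

(** Here [g] depends on [K] through the certificate of its closed loop; the bound is applied at the
    initial gain alone. *)
Lemma cost_quadratic_bound K : stab K ->
  exists2 g : R, 0 < g & f K - f Ks <= g * frob2 (K - Ks).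
Proof.
move=> sK; have [P P0 HP] := schur_lyap_bound sK.
have [h h0 Hh] := qf_bound (H Ks).
pose p := \sum_i dot (z i) (P *m z i).
have p0 : 0 <= p by rewrite sumr_ge0.
exists (h * (p + 1)) => [|]; first by rewrite mulr_gt0 // ltr_wpDl.
have KE : Ks + (K - Ks) = K by rewrite addrC subrK.
have F0 := frob2_ge0 (K - Ks).
have H1 x : dot x ((X K - X Ks) *m x) <= h * frob2 (K - Ks) * dot x (P *m x).
  apply: HP => y; have := @XK_diff Ks (K - Ks) sKs.
  rewrite KE => /(_ sK y); rewrite locmin_gain /= => ->; rewrite lerD2l.
  have := Hh ((K - Ks) *m y); rewrite ler_norml => /andP[_ Hy].
  apply: le_trans Hy _; rewrite -mulrA ler_pM2l //; exact: mulmx_frob2.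
have : f K - f Ks <= h * frob2 (K - Ks) * p.
  rewrite /cost !trace_Sigma -sumrB mulr_sumr; apply: ler_sum => i _.
  by rewrite -dotNr -dotDr -mulmxBl.
have : 0 <= h * frob2 (K - Ks) by rewrite mulr_ge0 // ltW.
lra.
Qed.

(** A Polyak-Lojasiewicz inequality. The gain is taken from [K] to [Ks], so the certificate [P] is
    that of the closed loop of [Ks] and [g] is uniform in [K]. *)
Lemma gradient_dominance : exists2 g : R, 0 < g &
  forall K, stab K -> g * (f K - f Ks) <= frob2 (E K).
Proof.
have [h h0 Hh] := hess_coercive.
have [P P0 HP] := schur_lyap_bound sKs.
pose p := \sum_i dot (z i) (P *m z i).
have p0 : 0 <= p by rewrite sumr_ge0.
have p1 : 0 < p + 1 by rewrite ltr_wpDl.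
exists (h / (p + 1)) => [|K sK]; first by rewrite divr_gt0.
have KE : K + (Ks - K) = Ks by rewrite addrC subrK.
have F0 := frob2_ge0 (E K).
have H1 x : dot x ((X K - X Ks) *m x) <= h^-1 * frob2 (E K) * dot x (P *m x).
  apply: HP => y; have := @XK_diff K (Ks - K) sK.
  rewrite KE => /(_ sKs y); rewrite /= -(opprB (X Ks)) !mulNmx !dotNr => ->.
  rewrite opprD lerD2l lerNl.
  set d := (Ks - K) *m y; set e := E K *m y.
  have Hd : h * dot d d <= dot d (H K *m d) by apply: le_trans (hess_minimal d sK).
  have He : dot e e <= frob2 (E K) * dot y y by apply: mulmx_frob2.
  (* Completing the square: minus the gain is at most [- 2 d^T e - h |d|^2 <= |e|^2 / h]. *)
  have : 0 <= h^-1 * dot (h *: d + e) (h *: d + e).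
    by rewrite mulr_ge0 ?dot_ge0 // invr_ge0 ltW.
  rewrite !(dotDl, dotDr, dotZl, dotZr) (dotC e d) !mulrDr !(mulKf (lt0r_neq0 h0)).
  rewrite -mulrA; have := ler_wpM2l (ltW (_ : 0 < h^-1)) He; rewrite invr_gt0.
  by move=> /(_ h0); lra.
have : f K - f Ks <= h^-1 * frob2 (E K) * p.
  rewrite /cost !trace_Sigma -sumrB mulr_sumr; apply: ler_sum => i _.
  by rewrite -dotNr -dotDr -mulmxBl.
rewrite -mulrA mulrC ler_pdivlMr // => H2.
rewrite mulrAC ler_pdivrMr //; nra.
Qed.

Lemma cost_minimal K : stab K -> 0 <= f K - f Ks.
Proof.
move=> sK; have [g g0 /(_ K sK)] := cost_quadratic_growth.
by apply: le_trans; rewrite mulr_ge0 ?frob2_ge0 // ltW.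
Qed.

(** One step lowers the cost by at least [(s / l) |E|^2], hence by [(s g / L) (f K - f Ks)], where
    [L] bounds every [l = lam_max (H K)] along the iteration. *)
Lemma ng_iter_contraction K0 : stab K0 -> exists2 q : R, 0 < q < 1 &
  forall j, f (ng_iter A B Q Rm K0 j) - f Ks <= q ^+ j * (f K0 - f Ks).
Proof.
move=> sK0; have [g g0 Hg] := gradient_dominance.
have [s s0 Hs] := spanning_frob2 spanz.
have [L [L0 leL]] : exists L, 0 < L /\ forall K, stab K ->
    (forall x, dot x (X K *m x) <= dot x (X K0 *m x)) -> lam_max (H K) <= L.
  exists (lam_max (H K0)); split=> [|K sK]; first exact: lam_max_gt0.
  exact: lam_max_mono.
(* The maximum with 1/2 keeps the rate positive. *)
pose q := Num.max (1 - L^-1 * (s * g)) 2%:R^-1.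
have q0 : 0 < q by rewrite lt_max invr_gt0 ltr0n orbT.
have rho0 : 0 < L^-1 * (s * g) by rewrite !mulr_gt0 // invr_gt0.
exists q => [|j]; first by rewrite q0 gt_max; apply/andP; split; lra.
elim: j => [|j IH]; first by rewrite expr0 mul1r.
have [sK le_X] := ng_iter_invariant j sK0.
rewrite ng_iterS exprS -mulrA; apply: le_trans (ler_wpM2l (ltW q0) IH).
move: sK le_X; set K := ng_iter _ _ _ _ _ _ => sK le_X.
have fK := cost_minimal sK.
have : f (K + ng_step K) <=
    f K - (lam_max (H K))^-1 * \sum_i dot (E K *m z i) (E K *m z i).
  rewrite /cost !trace_Sigma mulr_sumr -sumrB; apply: ler_sum => i _.
  exact: XK_ng_step.
move: (lam_max_gt0 sK) (leL K sK le_X); move: (lam_max _) => l l0 lL step.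
have il0 : 0 <= l^-1 by rewrite invr_ge0 ltW.
have leE := ler_wpM2l il0 (Hs _ (E K)).
have dec : L^-1 * (s * g * (f K - f Ks)) <= l^-1 * (s * frob2 (E K)).
  apply: ler_pM.
  - by rewrite invr_ge0 ltW.
  - by rewrite !mulr_ge0 // ltW.
  - by rewrite lef_pV2.
  - by rewrite -mulrA ler_pM2l // Hg.
have : (1 - L^-1 * (s * g)) * (f K - f Ks) <= q * (f K - f Ks).
  by apply: ler_wpM2r => //; rewrite le_max lexx.
lra.
Qed.

End LocalMinimizer.
End PolicyGradient.

Theorem theorem1 (R : realType) (n m : nat)
  (A : 'M[R]_n) (B : 'M[R]_(n, m)) (Q : 'M[R]_n) (Rm : 'M[R]_m)
  (z : 'I_n -> 'cV[R]_n)
  (Hstab : stabilizable A B)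
  (HQ : Q^T = Q) (HR : Rm^T = Rm)
  (Hz : spanning z)
  (Kstar : 'M[R]_(m, n))
  (HKstarS : stabilizing A B Kstar)
  (Hlocmin : exists delta : R, 0 < delta /\
     forall K : 'M[R]_(m, n), stabilizing A B K ->
       0 < frob (K - Kstar) -> frob (K - Kstar) < delta ->
       cost A B Q Rm z Kstar < cost A B Q Rm z K)
  (K0 : 'M[R]_(m, n)) (HK0 : stabilizing A B K0) :
  (forall j : nat, stabilizing A B (ng_iter A B Q Rm K0 j)) /\
  exists q1 c1 : R, 0 < q1 /\ q1 < 1 /\ 0 < c1 /\
    forall j : nat,
      cost A B Q Rm z (ng_iter A B Q Rm K0 j) - cost A B Q Rm z Kstar
        <= q1 ^+ j * (cost A B Q Rm z K0 - cost A B Q Rm z Kstar) /\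
      frob2 (ng_iter A B Q Rm K0 j - Kstar) <= c1 * q1 ^+ j * frob2 (K0 - Kstar).
Proof.
have [/andP[n0 m0]|nm0] := boolP ((0 < n)%N && (0 < m)%N).
  have sKj j := proj1 (ng_iter_invariant HQ HR n0 HKstarS Hlocmin m0 j HK0).
  split=> //.
  have [q /andP[q0 q1] Hq] := ng_iter_contraction HQ HR n0 Hz HKstarS Hlocmin m0 HK0.
  have [g g0 Hg] := cost_quadratic_growth HQ HR n0 Hz HKstarS Hlocmin.
  have [h h0 Hh] := cost_quadratic_bound HQ HR HKstarS Hlocmin HK0.
  (* Growth with [g] at the iterate and the upper bound with [h] at [K0] transfer the rate from
     costs to gains. *)
  exists q, (h / g); split=> //; split=> //; split=> [|j]; first exact: divr_gt0.
  split=> //; rewrite -(ler_pM2l g0).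
  apply: le_trans (Hg _ (sKj j)) _; apply: le_trans (Hq j) _.
  have -> : g * (h / g * q ^+ j * frob2 (K0 - Kstar)) =
      q ^+ j * (h * frob2 (K0 - Kstar)).
    by field; rewrite gt_eqF.
  by apply: ler_wpM2l => //; rewrite exprn_ge0 // ltW.
(* If [n] or [m] is 0 there is a single gain, and any admissible constants will do. *)
have all_eq (K K' : 'M[R]_(m, n)) : K = K'.
  apply/matrixP => i j; case/negP: nm0; apply/andP.
  by split; [apply: leq_ltn_trans (ltn_ord j) | apply: leq_ltn_trans (ltn_ord i)].
split=> [j|]; first by rewrite (all_eq (ng_iter A B Q Rm K0 j) K0).
exists (2%:R^-1), 1; rewrite invr_gt0 ltr0n invf_lt1 ?ltr0n // ltr1n ltr01.
do 3![split=> //] => j.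
rewrite (all_eq (ng_iter A B Q Rm K0 j) Kstar) (all_eq K0 Kstar) !subrr mulr0; split=> //.
by rewrite -(scale0r 0) frob2Z expr0n mul0r mulr0.
Qed.
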